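(* Let $\Gamma$ be a finite connected triangle-free and square-free graph with $D=\mathrm{diam}(\Gamma)\ge2$. For all $1\neq g\in A(\Gamma)$ there exists a $(10D,10D)$-quasi-geodesic $\gamma\colon[0,\ell]\to\Gamma^e$, an edge path parametrized by arc length, such that $\gamma(0)=v$ and $\gamma(\ell)=v^g$ for some $v\in V(\Gamma)$ and $$\sum_{i=1}^{\ell-1}d_{\mathrm{Lk}(\gamma(i))}(\gamma(i-1),\gamma(i+1))\asymp_{10D,10D}\|g\|_{\mathrm{syl}}.$$
   Context: Graphs are simplicial. Triangle-free (square-free) means no induced subgraph is a $3$-cycle ($4$-cycle). $A(\Gamma)=\langle V(\Gamma)\mid [a,b]=1 \text{ for each } \{a,b\}\in E(\Gamma)\rangle$. The extension graph $\Gamma^e$ has vertex set $\{v^g : v\in V(\Gamma), g\in A(\Gamma)\}$, $v^g=g^{-1}vg$, with two distinct vertices adjacent iff they commute; it carries the graph metric $d$. $\mathrm{Lk}(x)=\mathrm{Lk}_{\Gamma^e}(x)$ is the set of vertices of $\Gamma^e$ adjacent to $x$. The syllable length $\|g\|_{\mathrm{syl}}$ is the minimum $k$ such that $g$ is a product of $k$ elements of $\bigcup_{v\in V(\Gamma)}\langle v\rangle$. The notation $A\asymp_{K,C}B$ means $\frac1K B-C\le A\le KB+C$, and $\gamma$ is a $(K,C)$-quasi-geodesic if $d(\gamma(p),\gamma(q))\asymp_{K,C}|p-q|$ for all $p,q$. Here $\ell$ is an integer and $\gamma$ maps integers in $[0,\ell]$ to vertices, consecutive ones adjacent, so $\gamma(i-1),\gamma(i+1)\in\mathrm{Lk}(\gamma(i))$.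 Metric on links: for $u\in V(\Gamma)$, $L=\mathrm{Lk}_\Gamma(u)$ is discrete since $\Gamma$ is triangle-free, so $F=\langle L\rangle\le A(\Gamma)$ is free on $L$. One has $\mathrm{Lk}_{\Gamma^e}(u)=\{w^h : w\in L, h\in F\}$, identified with the extension graph $L^e$ of the discrete graph $L$, which is the graph on this vertex set in which two distinct vertices $w_1^{h_1}, w_2^{h_2}$ are adjacent iff there is $h\in F$ with $w_1^{h_1}=w_1^{h}$ and $w_2^{h_2}=w_2^{h}$; $d_{\mathrm{Lk}(u)}$ is its graph metric. For $x=u^h$, $\mathrm{Lk}(x)=\mathrm{Lk}(u)^h$ carries the metric transported by conjugation by $h$. *)

(* Defs.v *)
(* MathComp world, with the classical axioms of mathcomp.classical.boolp. *)
From HB Require Import structures.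
From mathcomp Require Import all_boot all_order all_algebra.
From mathcomp Require Import boolp.

Set Implicit Arguments.
Unset Strict Implicit.
Unset Printing Implicit Defensive.

Record sgraph := SGraph {
  svertex :> finType;
  sedge : rel svertex;
  sedge_sym : symmetric sedge;
  sedge_irrefl : irreflexive sedge }.

(* The minimum of a set of natural numbers, and 0 if the set is empty. *)
Definition natmin (P : nat -> Prop) : nat :=
  if pselect (exists n, `[< P n >]) is left exP then ex_minn exP else 0.

(* Only the values of [p] at [0, ..., l] matter. *)
Definition edge_path (T : Type) (adj : T -> T -> Prop) (l : nat)
    (p : nat -> T) : Prop :=
  forall i, i < l -> adj (p i) (p i.+1).

(* The graph metric.  It takes the value 0 on pairs of points that are not
   joined by a path; the graphs to which it is applied below (a connected
   graph, its extension graph, the links of the extension graph) are all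
   connected. *)
Definition gdist (T : Type) (adj : T -> T -> Prop) (x y : T) : nat :=
  natmin (fun n => exists p, [/\ edge_path adj n p, p 0 = x & p n = y]).

Section Graphs.
Variable G : sgraph.

Definition connected_graph : Prop := forall x y : G, connect (@sedge G) x y.

Definition has_induced_cycle (n : nat) : Prop :=
  exists2 f : 'I_n -> G, injective f &
    forall i j, sedge (f i) (f j) = (j == ordS i) || (i == ordS j).

Definition triangle_free : Prop := ~ has_induced_cycle 3.

Definition square_free : Prop := ~ has_induced_cycle 4.

Definition diam : nat := \max_(x : G) \max_(y : G) gdist (@sedge G) x y.

End Graphs.

Section Raag.
Variable G : sgraph.

(* [(v, true)] stands for the letter v, and [(v, false)] for its inverse. *)
Definition word : Type := seq (G * bool).

Inductive word_eq : word -> word -> Prop :=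
| word_eq_refl w : word_eq w w
| word_eq_sym w1 w2 : word_eq w1 w2 -> word_eq w2 w1
| word_eq_trans w1 w2 w3 : word_eq w1 w2 -> word_eq w2 w3 -> word_eq w1 w3
| word_eq_cat w1 w1' w2 w2' :
    word_eq w1 w1' -> word_eq w2 w2' -> word_eq (w1 ++ w2) (w1' ++ w2')
| word_eq_cancel v b : word_eq [:: (v, b); (v, ~~ b)] [::]
| word_eq_comm a b : sedge a b ->
    word_eq [:: (a, true); (b, true)] [:: (b, true); (a, true)].

Definition word_eqb : rel word := fun w1 w2 => `[< word_eq w1 w2 >].

Lemma word_eqb_refl : reflexive word_eqb.
Proof. by move=> w; apply/asboolP; exact: word_eq_refl. Qed.

Lemma word_eqb_sym : symmetric word_eqb.
Proof.
by move=> w1 w2; apply/asboolP/asboolP => h; exact: word_eq_sym.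
Qed.

Lemma word_eqb_trans : transitive word_eqb.
Proof.
move=> w2 w1 w3 /asboolP h12 /asboolP h23.
by apply/asboolP; exact: word_eq_trans h23.
Qed.

Canonical word_equiv := EquivRel word_eqb word_eqb_refl word_eqb_sym
  word_eqb_trans.

Definition word_inv (w : word) : word := rev [seq (l.1, ~~ l.2) | l <- w].

Lemma word_invK : involutive word_inv.
Proof.
move=> w; rewrite /word_inv map_rev revK -map_comp -[RHS]map_id.
by apply: eq_map => -[v b] /=; rewrite negbK.
Qed.

Lemma word_mulV (w : word) : word_eq (w ++ word_inv w) [::].
Proof.
elim: w => [|[v b] w IHw]; first exact: word_eq_refl.
apply: word_eq_trans (word_eq_cancel v b).
rewrite /word_inv /= rev_cons -cats1 -/(word_inv w) catA.
rewrite -(cat1s _ (_ ++ _)) -[X in word_eq _ X](cat1s (v, b) ([::] ++ _)).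
apply: word_eq_cat; first exact: word_eq_refl.
by apply: word_eq_cat IHw _; exact: word_eq_refl.
Qed.

Lemma word_Vmul (w : word) : word_eq (word_inv w ++ w) [::].
Proof. by have := word_mulV (word_inv w); rewrite word_invK. Qed.

Lemma word_eq_inv (w w' : word) :
  word_eq w w' -> word_eq (word_inv w) (word_inv w').
Proof.
move=> eqw.
have h1 : word_eq (word_inv w) (word_inv w ++ w' ++ word_inv w').
  rewrite -{1}[word_inv w]cats0; apply: word_eq_cat (word_eq_refl _) _.
  exact/word_eq_sym/word_mulV.
have h2 : word_eq (word_inv w ++ w' ++ word_inv w')
                  (word_inv w ++ w ++ word_inv w').
  apply: word_eq_cat (word_eq_refl _) _.
  exact: word_eq_cat (word_eq_sym eqw) (word_eq_refl _).
apply: word_eq_trans h1 _; apply: word_eq_trans h2 _; rewrite catA.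
exact: (word_eq_cat (word_Vmul w) (word_eq_refl (word_inv w'))).
Qed.

Local Open Scope quotient_scope.

Definition raag : Type := {eq_quot word_equiv}.

HB.instance Definition _ := Choice.on raag.
HB.instance Definition _ := EqQuotient.on raag.

Lemma raag_eqP (w w' : word) : word_eq w w' <-> \pi_raag w = \pi_raag w'.
Proof.
by split=> [h|/eqmodP/asboolP//]; apply/eqmodP/asboolP.
Qed.

Lemma repr_pi (w : word) : word_eq (repr (\pi_raag w)) w.
Proof. by apply/raag_eqP; rewrite reprK. Qed.

Definition raag_one : raag := \pi_raag [::].
Definition raag_mul (x y : raag) : raag := \pi_raag (repr x ++ repr y).
Definition raag_inv (x : raag) : raag := \pi_raag (word_inv (repr x)).

Lemma raag_mul_pi w w' :
  raag_mul (\pi_raag w) (\pi_raag w') = \pi_raag (w ++ w').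
Proof. by apply/raag_eqP; apply: word_eq_cat; exact: repr_pi. Qed.

Lemma raag_inv_pi w : raag_inv (\pi_raag w) = \pi_raag (word_inv w).
Proof. by apply/raag_eqP; apply: word_eq_inv; exact: repr_pi. Qed.

Lemma raag_mulA : associative raag_mul.
Proof.
elim/quotW=> w1; elim/quotW=> w2; elim/quotW=> w3.
by rewrite (raag_mul_pi w1 w2) (raag_mul_pi w2 w3) !raag_mul_pi catA.
Qed.

Lemma raag_mul1 : left_id raag_one raag_mul.
Proof. by elim/quotW=> w; rewrite raag_mul_pi. Qed.

Lemma raag_mulr1 : right_id raag_one raag_mul.
Proof. by elim/quotW=> w; rewrite raag_mul_pi cats0. Qed.

Lemma raag_mulVr : left_inverse raag_one raag_inv raag_mul.
Proof.
elim/quotW=> w; rewrite raag_inv_pi raag_mul_pi.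
by apply/raag_eqP; exact: word_Vmul.
Qed.

Lemma raag_mulrV : right_inverse raag_one raag_inv raag_mul.
Proof.
elim/quotW=> w; rewrite raag_inv_pi raag_mul_pi.
by apply/raag_eqP; exact: word_mulV.
Qed.

HB.instance Definition _ := isGroup.Build raag raag_mulA
  raag_mul1 raag_mulr1 raag_mulVr raag_mulrV.

Definition gen (v : G) : raag := \pi_raag [:: (v, true)].

End Raag.

Local Open Scope group_scope.

Inductive subgroup_gen (H : groupType) (S : H -> Prop) : H -> Prop :=
| subgroup_gen_in x : S x -> subgroup_gen S x
| subgroup_gen_one : subgroup_gen S 1
| subgroup_gen_mul x y :
    subgroup_gen S x -> subgroup_gen S y -> subgroup_gen S (x * y)
| subgroup_gen_inv x : subgroup_gen S x -> subgroup_gen S x^-1.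

Section ExtensionGraph.
Variable G : sgraph.

Definition syllable (x : raag G) : Prop :=
  exists v : G, subgroup_gen (fun y => y = gen v) x.

Definition syl_length (g : raag G) : nat :=
  natmin (fun k => exists s : seq (raag G),
    [/\ size s = k, (forall x, x \in s -> syllable x)
      & \prod_(x <- s) x = g]).

Definition ext_vertex (x : raag G) : Prop :=
  exists (v : G) (g : raag G), x = gen v ^ g.

Definition ext_adj (x y : raag G) : Prop :=
  [/\ ext_vertex x, ext_vertex y, x <> y & commute x y].

Definition link_group (u : G) : raag G -> Prop :=
  subgroup_gen (fun y => exists2 w : G, sedge u w & y = gen w).

(* Adjacency in the extension graph of the discrete graph Lk(u); its vertices
   are regarded as elements of A(G). *)
Definition link_adj (u : G) (y z : raag G) : Prop :=
  y <> z /\ exists (w1 w2 : G) (h : raag G),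
    [/\ sedge u w1, sedge u w2, link_group u h, y = gen w1 ^ h
      & z = gen w2 ^ h].

(* The metric of Lk(x), for x = u^h, transported from Lk(u) by conjugation.
   It does not depend on the choice of (u, h): u is determined by x, and h is
   determined up to left multiplication by an element of the centralizer
   <u> * link_group u of u, which acts on Lk(u) by isometries.  So the minimum
   is over a single value. *)
Definition link_dist (x y z : raag G) : nat :=
  natmin (fun n => exists (u : G) (h : raag G),
    x = gen u ^ h /\ n = gdist (link_adj u) (y ^ h^-1) (z ^ h^-1)).

End ExtensionGraph.

Local Open Scope ring_scope.

Definition asymp (K C A B : rat) : Prop :=
  K^-1 * B - C <= A /\ A <= K * B + C.

(* A quasi-geodesic on the integer points of [0, l]. *)
Definition quasi_geodesic (T : Type) (adj : T -> T -> Prop) (K C : rat)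
    (l : nat) (gamma : nat -> T) : Prop :=
  forall p q : nat, (p <= l)%N -> (q <= l)%N ->
    asymp K C (gdist adj (gamma p) (gamma q))%:R `|p%:R - q%:R|.

(* Main.v *)
Require Import Defs.
From mathcomp Require Import all_boot all_order all_algebra.
From mathcomp Require Import boolp.
From mathcomp Require Import ring zify.

(** Let [v] be a vertex of the graph with a neighbour [w]. The path [gamma]
    is a geodesic [x_0 = v, ..., x_l = v^g] of the extension graph with a
    hair of length two at each end: it runs through [v, w, x_0, ..., x_l,
    w^g, v^g]. A geodesic with such hairs is a quasi-geodesic
    ([hair_quasi_geodesic]). The hairs make [x_0] and [x_l] inner points of
    [gamma], so that the link distances at these points contribute to the
    sum. If [g] centralizes [v], for example, then [l = 0], and the link
    distance at [v] between [w] and [w^g] is all that sees [g].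

    Every edge of the extension graph is a conjugate of an edge of the
    graph ([ext_adj_frame]). Hence a walk from [v] to [v^g] of length [l] is
    the same as a factorization [g^-1 = b_0 ... b_l], where [b_i] lies in
    the subgroup generated by the star of a vertex [u_i] and [u_0, ..., u_l]
    is a walk of the graph from [v] to [v]; then [x_i] is the conjugate of
    [u_i] by the inverse of [b_0 ... b_(i-1)] ([walk_blocks]). Write [b_i]
    as a syllable word [t_i] in the star of [u_i]. If the concatenation of
    the [t_i] is not reduced, then two of its syllables merge or one is
    trivial; shortening the word there keeps each [t_i] in its star, and
    keeps the walk a geodesic, as [u_i] and [l] do not change
    ([blocks_reduce]). So the concatenation may be taken to be reduced, and
    then the [t_i] have [|g|] syllables altogether, where [|.|] is the
    syllable length.

    Let [d_i] be the link distance at [x_i]. A path in the link that spells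
    the part of [t_i] outside [u_i], one syllable at each step, gives [d_i
    <= |t_i| + 1] ([link_dist_le]). Conversely, a path of length [d_i] in
    the link writes [b_i] with [d_i + 1] syllables, up to a power of [u_i],
    so [|b_i| <= d_i + 2] ([link_dist_ge]). This uses triangle-freeness: in
    the subgroup generated by the link of [u], only powers of [w] commute
    with a neighbour [w] of [u]. Summing the first bound, the sum is at most
    [|g| + l + 3], and [l <= D (|g| + 1)], where [D] is the diameter of the
    graph, because [D] steps suffice to reach the next syllable
    ([ext_walk]). Summing the second, [|g|] is at most three times the sum
    plus four, because a geodesic does not backtrack and so [d_i >= 1] for
    [0 < i < l].

    The algebra rests on one normal form theorem, [reduced_subword]: if [t]
    is a reduced syllable word, every syllable word with the same value has
    a subword whose generators are those of [t] up to order. It is proved as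
    Magnus did for free groups: a generator [v] acts as [1 + X_v], where
    [X_v] squares to zero and [X_v], [X_w] commute when [v], [w] are
    adjacent. The syllable [v^e] acts as [1 + e X_v], so the product of a
    syllable word involves only the monomials of its subwords, and the
    monomial of [t] itself has the product of the exponents of [t] as
    coefficient. Centralizers of generators ([centralizer]) and commuting
    conjugates of generators ([commute_gen_conj]) are read off from it. *)

Set Implicit Arguments.
Unset Strict Implicit.
Unset Printing Implicit Defensive.

Import Order.TTheory GRing.Theory Num.Theory.

(** * Integer powers *)

Section IntegerPowers.
Variable H : groupType.
Local Open Scope group_scope.

Definition zpow (x : H) (e : int) : H :=
  match e with Posz n => x ^+ n | Negz n => x ^- n.+1 end.

Lemma zpowS (x : H) (e : int) : zpow x (e + 1)%R = zpow x e * x.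
Proof.
case: e => [n|[|n]].
- have -> : (Posz n + 1 = Posz n.+1)%R by lia.
  by rewrite /= expgSr.
- by rewrite /= mulVg.
have -> : (Negz n.+1 + 1 = Negz n)%R by lia.
by rewrite /= [x ^+ n.+2]expgS invgM mulgVK.
Qed.

Lemma zpowD (x : H) (e f : int) : zpow x (e + f)%R = zpow x e * zpow x f.
Proof.
elim/int_rect: f => [|n IHn|n IHn].
- by rewrite addr0 mulg1.
- have -> : (e + Posz n.+1 = e + Posz n + 1)%R by lia.
  have -> : (Posz n.+1 = Posz n + 1)%R by lia.
  by rewrite !zpowS IHn mulgA.
apply: (@mulIg H x); rewrite -mulgA -!zpowS.
have -> : (e + - Posz n.+1 + 1 = e + - Posz n)%R by lia.
by have -> : (- Posz n.+1 + 1 = - Posz n)%R by lia.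
Qed.

Lemma zpowN (x : H) (e : int) : zpow x (- e)%R = (zpow x e)^-1.
Proof. by apply/esym/mulg1_eq; rewrite -zpowD subrr. Qed.

Lemma commute_zpow (x y : H) (e : int) : commute x y -> commute x (zpow y e).
Proof.
by case: e => n cxy; [|apply: commuteV]; apply: commuteX.
Qed.

End IntegerPowers.

(** * Syllable words and shadows *)

Section SyllableWords.
Variable G : sgraph.
Local Notation sword := (seq (G * int)).

Local Notation gens := (@unzip1 G int).

Definition eval (t : sword) : raag G :=
  (\prod_(s <- t) zpow (gen s.1) s.2)%g.

Lemma eval_nil : eval [::] = 1%g.
Proof. exact: big_nil. Qed.

Lemma eval_cons s t : eval (s :: t) = (zpow (gen s.1) s.2 * eval t)%g.
Proof. exact: big_cons. Qed.

Lemma eval_cat t1 t2 : eval (t1 ++ t2) = (eval t1 * eval t2)%g.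
Proof. exact: big_cat. Qed.

Definition sword_inv (t : sword) : sword := rev [seq (s.1, - s.2)%R | s <- t].

Lemma eval_inv t : eval (sword_inv t) = (eval t)^-1%g.
Proof.
elim: t => [|s t IHt]; first by rewrite eval_nil; apply/esym; rewrite invg1 -eval_nil.
rewrite /sword_inv /= rev_cons -cats1 eval_cat -/(sword_inv t) IHt.
by rewrite !eval_cons eval_nil mulg1 /= zpowN invgM.
Qed.

Lemma gens_inv t : gens (sword_inv t) = rev (gens t).
Proof. by rewrite /unzip1 /sword_inv map_rev -map_comp. Qed.

Lemma size_inv t : size (sword_inv t) = size t.
Proof. by rewrite size_rev size_map. Qed.

Lemma gen_commute a b : sedge a b -> commute (gen a) (gen b : raag G).
Proof.
move=> ab; rewrite /commute /gen.
by rewrite [LHS]raag_mul_pi [RHS]raag_mul_pi; apply/raag_eqP/word_eq_comm.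
Qed.

Lemma eval_commute a (t : sword) :
  all (fun x => (x == a) || sedge a x) (gens t) -> commute (gen a) (eval t).
Proof.
elim: t => [_|[x e] t IHt /= /andP[ax /IHt ct]].
  by rewrite eval_nil; exact: commute1.
rewrite eval_cons; apply: commuteM ct; apply: commute_zpow.
by case/orP: ax => [/eqP -> //|/gen_commute].
Qed.

(** The positions of [v] among the letters that do not commute past [v].  The
    shadows of a word do not change when adjacent commuting letters are swapped,
    so they serve as invariants of the trace of the word, that is of its class
    under such swaps. *)
Definition shadow (v : G) (m : seq G) : seq bool :=
  [seq x == v | x <- m & ~~ sedge v x].

Lemma shadow_cat v m1 m2 : shadow v (m1 ++ m2) = shadow v m1 ++ shadow v m2.
Proof. by rewrite /shadow filter_cat map_cat. Qed.

Lemma shadow_swap v x y m1 m2 : sedge x y ->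
  shadow v (m1 ++ x :: y :: m2) = shadow v (m1 ++ y :: x :: m2).
Proof.
move=> xy; rewrite !shadow_cat; congr (_ ++ _); rewrite /shadow /=.
have yx : sedge y x by rewrite sedge_sym.
case vx: (sedge v x); case vy: (sedge v y) => //=.
have /negbTE -> : x != v by apply: contraFneq vy => <-.
have /negbTE -> : y != v by apply: contraFneq vx => <-.
by [].
Qed.

Lemma shadow_count v m : count_mem v m = count id (shadow v m).
Proof.
elim: m => [//|x m IHm]; rewrite /shadow /= IHm /shadow.
by case vx: (sedge v x) => //=; case: eqP vx => // ->; rewrite sedge_irrefl.
Qed.

Lemma shadow_perm m1 m2 :
  (forall v, shadow v m1 = shadow v m2) -> perm_eq m1 m2.
Proof.
by move=> e; apply/allP => x _ /=; rewrite !shadow_count e.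
Qed.

Lemma shadow_split v m s1 s2 : shadow v m = s1 ++ true :: s2 ->
  exists m1 m2, [/\ m = m1 ++ v :: m2, shadow v m1 = s1 & shadow v m2 = s2].
Proof.
elim: m s1 => [|x m IHm] s1; first by case: s1.
rewrite {1}/shadow /=; case vx: (sedge v x) => /=.
  case/IHm=> m1 [m2 [-> e1 e2]]; exists (x :: m1), m2; split=> //.
  by rewrite /shadow /= vx.
case: s1 => [|b s1] /=; rewrite -/(shadow v m).
  by case=> /eqP -> <-; exists [::], m.
case=> e0 /IHm [m1 [m2 [-> e1 e2]]]; exists (x :: m1), m2; split=> //.
by rewrite /shadow /= vx /= e0 -e1.
Qed.

Lemma shadow_nil v m : shadow v m = [::] -> all (sedge v) m.
Proof.
elim: m => // x m IHm; rewrite /shadow /=.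
by case: (sedge v x).
Qed.

(** No swaps of commuting letters bring two occurrences of a letter together. *)
Definition unmergeable (m : seq G) : Prop :=
  forall v m1 m2 m3, m = m1 ++ v :: m2 ++ v :: m3 -> ~~ all (sedge v) m2.

Lemma unmergeable_shadow m v m1 m2 :
  unmergeable m -> shadow v (m1 ++ v :: v :: m2) <> shadow v m.
Proof.
move=> um /esym; rewrite shadow_cat {3}/shadow /= sedge_irrefl /= eqxx.
case/shadow_split => n1 [n2 [em _ e2]].
case: (@shadow_split v n2 [::] (shadow v m2) e2) => n3 [n4 [en /shadow_nil a3 _]].
by move: (um v n1 n3 n4); rewrite a3 em en => /(_ erefl).
Qed.

(** * A square-zero Magnus action *)

Local Open Scope ring_scope.

Local Notation coefs := (seq G -> int).

(** Functions on words that are linear forms on the algebra with generators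
    [X_v], [v] in [G], and relations [X_v X_w = X_w X_v] for adjacent [v], [w]
    and [X_v X_v = 0], evaluated on monomials. *)
Definition trace_fun (phi : coefs) : Prop :=
  (forall v w m1 m2, sedge v w ->
     phi (m1 ++ v :: w :: m2) = phi (m1 ++ w :: v :: m2)) /\
  (forall v m1 m2, phi (m1 ++ v :: v :: m2) = 0).

(** The transpose of left multiplication by [1 + e X_v]. *)
Definition act1 (phi : coefs) (s : G * int) : coefs :=
  fun m => phi m + s.2 * phi (s.1 :: m).

Definition act (phi : coefs) (t : sword) : coefs := foldl act1 phi t.

Lemma act1_trace phi s : trace_fun phi -> trace_fun (act1 phi s).
Proof.
move=> [comm sq]; split=> [v w m1 m2 vw|v m1 m2]; rewrite /act1.
  by rewrite (comm v w m1) // (comm v w (s.1 :: m1)).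
by rewrite (sq v m1) (sq v (s.1 :: m1)) mulr0 addr0.
Qed.

Definition letter_exp (l : G * bool) : G * int := (l.1, if l.2 then 1 else -1).

Definition actw (phi : coefs) (w : word G) : coefs :=
  act phi (map letter_exp w).

Lemma actw_cat phi w1 w2 : actw phi (w1 ++ w2) = actw (actw phi w1) w2.
Proof. by rewrite /actw map_cat /act foldl_cat. Qed.

Lemma actw_trace phi w : trace_fun phi -> trace_fun (actw phi w).
Proof.
rewrite /actw; elim: w phi => // l w IHw phi tp.
by apply: IHw; apply: act1_trace.
Qed.

(** The action of words descends to the group: since [X_v] squares to zero,
    [1 - X_v] is the inverse of [1 + X_v]. *)
Lemma actw_eq phi w1 w2 : trace_fun phi -> word_eq w1 w2 ->
  actw phi w1 = actw phi w2.
Proof.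
move=> tp e; elim: e phi tp => {w1 w2}.
- by [].
- by move=> w1 w2 _ IH phi tp; rewrite IH.
- by move=> w1 w2 w3 _ IH1 _ IH2 phi tp; rewrite IH1 // IH2.
- move=> w1 w1' w2 w2' _ IH1 _ IH2 phi tp.
  by rewrite !actw_cat IH1 // IH2 //; apply: actw_trace.
- move=> v b phi [_ sq]; apply: funext => m; rewrite /actw /= /act1 /=.
  by rewrite (sq v [::]); case: b => /=; ring.
move=> a b ab phi [comm _]; apply: funext => m; rewrite /actw /= /act1 /=.
by rewrite (comm a b [::] m ab) /=; ring.
Qed.

Definition actg (phi : coefs) (x : raag G) : coefs := actw phi (repr x).

Lemma actg_pi phi w : trace_fun phi ->
  actg phi (\pi_(raag G) w)%qT = actw phi w.
Proof. by move=> tp; apply: actw_eq tp _; apply: repr_pi. Qed.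

Lemma actg1 phi : trace_fun phi -> actg phi 1%g = phi.
Proof. by move=> tp; rewrite [1%g]/(raag_one G) actg_pi. Qed.

Lemma actgM phi x y : trace_fun phi -> actg phi (x * y)%g = actg (actg phi x) y.
Proof.
move=> tp; rewrite [(x * y)%g]/(raag_mul x y) /raag_mul actg_pi //.
exact: actw_cat.
Qed.

Lemma actg_trace phi x : trace_fun phi -> trace_fun (actg phi x).
Proof. exact: actw_trace. Qed.

Lemma actg_gen phi v : trace_fun phi -> actg phi (gen v) = act1 phi (v, 1).
Proof. by move=> tp; rewrite /gen actg_pi. Qed.

Lemma act1D phi v e f : trace_fun phi ->
  act1 (act1 phi (v, e)) (v, f) = act1 phi (v, e + f).
Proof.
move=> [_ sq]; apply: funext => m; rewrite /act1 /= (sq v [::]); ring.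
Qed.

Lemma actg_zpow phi v e : trace_fun phi ->
  actg phi (zpow (gen v) e) = act1 phi (v, e).
Proof.
have act10 psi : act1 psi (v, 0) = psi.
  by apply: funext => m; rewrite /act1 /= mul0r addr0.
have posX n psi : trace_fun psi -> actg psi (gen v ^+ n)%g = act1 psi (v, n%:Z).
  move=> tp; elim: n => [|n IHn]; first by rewrite actg1 // act10.
  rewrite expgSr actgM // IHn actg_gen; last exact: act1_trace.
  have -> : n.+1%:Z = n%:Z + 1 by lia.
  by rewrite act1D.
case: e => n tp /=; first exact: posX.
have tx : trace_fun (actg phi (gen v ^- n.+1)%g) by exact: actg_trace.
rewrite -[LHS]act10 -(subrr n.+1%:Z) -act1D // -posX // -actgM //.
by rewrite mulVg actg1 // NegzE.
Qed.

Lemma actg_eval phi t : trace_fun phi -> actg phi (eval t) = act phi t.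
Proof.
elim: t phi => [|[v e] t IHt] phi tp; first by rewrite eval_nil actg1.
by rewrite eval_cons actgM // actg_zpow // IHt //; apply: act1_trace.
Qed.

(** The expansion of a product of factors [1 + e X_v] has only monomials that are
    subwords. *)
Lemma act_eq0 phi t m :
  (forall s, subseq s (gens t) -> phi (s ++ m) = 0) -> act phi t m = 0.
Proof.
elim: t phi => [|[v e] t IHt] phi h0; first exact: (h0 [::]).
apply: IHt => s st; rewrite /act1 /= (h0 s) ?add0r; last first.
  exact: subseq_trans st (subseq_cons _ _).
by rewrite (h0 (v :: s)) ?mulr0 //= eqxx.
Qed.

(** The full word arises from the expansion only by taking the second term in
    every factor. *)
Lemma act_top phi t m :
  (forall s, subseq s (gens t) -> (size s < size t)%N -> phi (s ++ m) = 0) ->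
  act phi t m = (\prod_(s <- t) s.2) * phi (gens t ++ m).
Proof.
elim: t phi => [|[v e] t IHt] phi h0; first by rewrite big_nil mul1r.
rewrite big_cons /= [LHS](IHt (act1 phi (v, e))).
  rewrite /act1 /= (h0 (gens t)) ?add0r; first by rewrite mulrCA mulrA.
    exact: subseq_cons.
  by rewrite size_map.
move=> s st lt; rewrite /act1 /= (h0 s) ?add0r.
- by rewrite (h0 (v :: s)) ?mulr0 //= eqxx.
- exact: subseq_trans st (subseq_cons _ _).
exact: ltnW.
Qed.

(** * Reduced syllable words *)

Definition reduced (t : sword) : Prop :=
  all (fun s => s.2 != 0) t /\ unmergeable (gens t).

Definition shadows (m : seq G) : {ffun G -> seq bool} := [ffun v => shadow v m].

(** A word with the same shadows as an unmergeable one never has a square, so the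
    indicator function of the shadows of [m] vanishes where it has to. *)
Lemma shadow_trace m : unmergeable m ->
  trace_fun (fun m' => (shadows m' == shadows m)%:Z).
Proof.
move=> um; split=> [v w m1 m2 vw|v m1 m2].
  congr (nat_of_bool (_ == _))%:Z; apply/ffunP => u.
  by rewrite !ffunE (shadow_swap u m1 m2 vw).
case: eqP => // /ffunP /(_ v); rewrite !ffunE.
by move/(unmergeable_shadow um).
Qed.

(** Compare the coefficients of the monomial of [t]: on the side of [t] it is the
    product of the exponents, which is not zero; on the side of [s] it comes from
    subwords of [s]. *)
Lemma reduced_subword t s : reduced t -> eval t = eval s ->
  exists2 m, subseq m (gens s) & perm_eq m (gens t).
Proof.
move=> [/allP nz um] e.
pose phi m' := (shadows m' == shadows (gens t))%:Z.
have tp : trace_fun phi by exact: shadow_trace.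
have phiP m' : phi m' != 0 -> perm_eq m' (gens t).
  rewrite /phi; case: (shadows m' =P _) => [/ffunP em _|//].
  apply: shadow_perm => v.
  by have := em v; rewrite !ffunE.
have et : act phi t [::] = (\prod_(x <- t) x.2) * phi (gens t ++ [::]).
  apply: act_top => m _; rewrite cats0 => lt; apply/eqP; apply: contraTT lt.
  by move=> /phiP /perm_size ->; rewrite size_map ltnn.
have nz0 : act phi t [::] != 0.
  rewrite et cats0 /phi eqxx mulr1 prodf_seq_neq0.
  by apply/allP => x /nz.
have : act phi s [::] != 0 by rewrite -actg_eval // -e actg_eval.
apply: contra_neqP => no; apply: act_eq0 => m ms; rewrite cats0.
apply/eqP; apply: contra_notT no => /phiP pm.
by exists m.
Qed.

Lemma gens_split t m1 v m2 : gens t = m1 ++ v :: m2 ->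
  exists t1 e t2, [/\ t = t1 ++ (v, e) :: t2, gens t1 = m1 & gens t2 = m2].
Proof.
elim: t m1 => [|[w e] t IHt] [|x m1] //=.
  by case=> -> <-; exists [::], e, t.
case=> -> /IHt [t1 [f [t2 [-> <- <-]]]].
by exists ((x, e) :: t1), f, t2.
Qed.

(** The two ways to shorten a word that is not reduced. *)
Lemma nonreducedP t : ~ reduced t ->
  (exists v t1 t2, t = t1 ++ (v, 0) :: t2) \/
  (exists v e f t1 t2 t3, t = t1 ++ (v, e) :: t2 ++ (v, f) :: t3 /\
     all (sedge v) (gens t2)).
Proof.
move=> nr; case az : (all (fun s => s.2 != 0) t); last first.
  left; move/negbT/allPn: az => -[[v e] vt /=]; rewrite negbK => /eqP e0.
  by case/splitPr: vt => t1 t2; exists v, t1, t2; rewrite e0.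
right; apply: contrapT => no; apply: nr; split=> // v m1 m2 m3 em.
apply/negP => a2; apply: no.
case: (gens_split em) => t1 [e [t' [-> _ /gens_split]]].
case=> t2 [f [t3 [-> e2 _]]].
by exists v, e, f, t1, t2, t3; rewrite e2.
Qed.

Lemma zpow_commute v e (t : sword) : all (sedge v) (gens t) ->
  commute (eval t) (zpow (gen v) e).
Proof.
move=> at_; apply: commute_zpow; apply: commute_sym; apply: eval_commute.
by apply: sub_all at_ => x ->; rewrite orbT.
Qed.

Lemma eval_front v e (t1 t2 : sword) : all (sedge v) (gens t1) ->
  eval (t1 ++ (v, e) :: t2) = (zpow (gen v) e * eval (t1 ++ t2))%g.
Proof.
move=> /(zpow_commute e) c.
by rewrite !eval_cat eval_cons /= !mulgA c.
Qed.

Lemma eval_back v e (t1 t2 : sword) : all (sedge v) (gens t2) ->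
  eval (t1 ++ (v, e) :: t2) = (eval (t1 ++ t2) * zpow (gen v) e)%g.
Proof.
by move=> /(zpow_commute e) c; rewrite !eval_cat eval_cons /= -mulgA c.
Qed.

Lemma eval_merge v e f (t1 t2 t3 : sword) : all (sedge v) (gens t2) ->
  eval (t1 ++ (v, e) :: t2 ++ (v, f) :: t3) =
  eval (t1 ++ (v, e + f) :: t2 ++ t3).
Proof.
move=> a2; rewrite eval_cat eval_cons eval_front // [RHS]eval_cat eval_cons.
by rewrite /= zpowD -!mulgA.
Qed.

Lemma reduce (t : sword) : exists2 t', reduced t' &
  [/\ eval t' = eval t, (size t' <= size t)%N & {subset gens t' <= gens t}].
Proof.
have [n] := ubnP (size t); elim: n t => // n IHn t; rewrite ltnS => tn.
have [rt|/nonreducedP nr] := pselect (reduced t); first by exists t; last split.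
have [t' [lt et st]] : exists t', [/\ (size t' < size t)%N, eval t' = eval t
    & {subset gens t' <= gens t}].
  case: nr => [[v [t1 [t2 ->]]]|[v [e [f [t1 [t2 [t3 [-> a2]]]]]]]].
    exists (t1 ++ t2); split.
    - by rewrite !size_cat /= addnS.
    - by rewrite !(eval_cat, eval_cons) mul1g.
    apply: mem_subseq; rewrite /unzip1 !map_cat.
    by apply: cat_subseq; [exact: subseq_refl | exact: subseq_cons].
  exists (t1 ++ (v, e + f) :: t2 ++ t3); split.
  - by rewrite !size_cat /= !size_cat /= !addnS.
  - by rewrite eval_merge.
  apply: mem_subseq; rewrite /unzip1 !(map_cat, map_cons) /=.
  apply: cat_subseq; [exact: subseq_refl | rewrite /= eqxx].
  by apply: cat_subseq; [exact: subseq_refl | exact: subseq_cons].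
have [t'' r [e1 s1 g1]] := IHn t' (leq_trans lt tn).
exists t'' => //; split; first by rewrite e1.
  exact: leq_trans s1 (ltnW lt).
by move=> x /g1 /st.
Qed.

Lemma reduced_size t s : reduced t -> eval t = eval s -> (size t <= size s)%N.
Proof.
move=> rt /(reduced_subword rt) [m /size_subseq + /perm_size].
by rewrite !size_map => + <-.
Qed.

Lemma reduced_support t s : reduced t -> eval t = eval s ->
  {subset gens t <= gens s}.
Proof.
move=> rt /(reduced_subword rt) [m /mem_subseq ms pm] x.
by rewrite -(perm_mem pm) => /ms.
Qed.

End SyllableWords.

(** * Merging and conjugation *)

Section Centralizers.
Variable G : sgraph.
Local Notation sword := (seq (G * int)).
Local Notation gens := (@unzip1 G int).
Local Open Scope group_scope.

Definition nand : rel bool := fun a b => ~~ (a && b).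

Lemma nandC : symmetric nand.
Proof. by case; case. Qed.

(** A word is unmergeable when no shadow has two consecutive marks, which is
    sortedness for [nand].  In this form concatenation is easy to handle, as an
    unmarked position separates the marks on its two sides. *)
Lemma sorted_nand_false s1 s2 :
  sorted nand (s1 ++ false :: s2) = sorted nand s1 && sorted nand s2.
Proof.
case: s1 => [|b s1] /=; first by case: s2.
rewrite cat_path /= {2}/nand andbF /=; congr (_ && _).
by case: s2.
Qed.

Lemma sorted_nand_rev s : sorted nand (rev s) = sorted nand s.
Proof. by rewrite rev_sorted; apply: eq_sorted => a b; rewrite nandC. Qed.

Lemma sorted_nandPn s : ~~ sorted nand s ->
  exists s1 s2, s = s1 ++ true :: true :: s2.
Proof.
elim: s => // a [//|b s] IHs; rewrite /= negb_and.
case/orP => [|/IHs [s1 [s2 ->]]]; last by exists (a :: s1), s2.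
by rewrite negbK => /andP[-> ->]; exists [::], s.
Qed.

Lemma unmergeableP (m : seq G) :
  unmergeable m <-> forall v, sorted nand (shadow v m).
Proof.
split=> [um v|sm v m1 m2 m3 em].
  apply: contrapT => /negP /sorted_nandPn [s1 [s2]].
  case/shadow_split => n1 [n2 [em _]].
  move/(@shadow_split _ _ _ [::]) => [n3 [n4 [en /shadow_nil a3 _]]].
  by move: (um v n1 n3 n4); rewrite a3 em en => /(_ erefl).
apply/negP => a2; have := sm v; rewrite em shadow_cat.
have -> : shadow v (v :: m2 ++ v :: m3) = true :: true :: shadow v m3.
  rewrite -cat_cons shadow_cat /shadow /= sedge_irrefl /= eqxx.
  rewrite [X in _ :: (map _ X) ++ _](_ : _ = [::]) //.
  apply/eqP; rewrite -[_ == _]negbK -has_filter -all_predC.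
  by apply: sub_all a2 => x /= ->.
have ntt : nand true true = false by [].
by case: (shadow v m1) => [|a s]; rewrite /= ?cat_path /= ?ntt ?andbF.
Qed.

Definition star (u : G) : pred G := fun x => (x == u) || sedge u x.

Lemma star_sym u x : star u x = star x u.
Proof. by rewrite /star eq_sym sedge_sym. Qed.

Lemma shadow_rev v (m : seq G) : shadow v (rev m) = rev (shadow v m).
Proof. by rewrite /shadow filter_rev map_rev. Qed.

(** In the shadow of [v], a square of [rev m ++ w :: m] would have to be at the
    centre: either [w] is not marked and does not separate the two halves, or it
    is itself a mark.  In both cases [w] belongs to the star of [v], and [m] has
    an occurrence of [v] that can be moved to its front. *)
Lemma conj_unmergeable w (m : seq G) : unmergeable m ->
  (forall v m1 m2, m = m1 ++ v :: m2 -> star w v -> ~~ all (sedge v) m1) ->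
  unmergeable (rev m ++ w :: m).
Proof.
move=> /unmergeableP sm hw; apply/unmergeableP => v.
rewrite shadow_cat -cat1s shadow_cat shadow_rev.
have [wv|nwv] := boolP (star w v); last first.
  have -> : shadow v [:: w] = [:: false].
    move: nwv; rewrite star_sym /star negb_or => /andP[/negbTE wv vw].
    by rewrite /shadow /= vw /= wv.
  by rewrite sorted_nand_false sorted_nand_rev sm.
have := sm v; have := @shadow_split G v m [::].
case: (shadow v m) => [|[] s] split1.
- by move=> _; rewrite /shadow /=; case: (sedge v w).
- case: (split1 s erefl) => m1 [m2 [em /shadow_nil a1 _]].
  by move: (hw _ _ _ em wv); rewrite a1.
rewrite -[false :: s]/([::] ++ false :: s) sorted_nand_false /= => ss.
rewrite rev_cons -cats1 -catA /= sorted_nand_false sorted_nand_rev ss /=.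
by rewrite sorted_nand_false ss andbT /shadow /=; case: (sedge v w).
Qed.

(** * Centralizers and conjugates of generators *)

Lemma commute_conj (x y : raag G) : commute x y -> x ^ y = x.
Proof. by move=> c; rewrite conjgE c mulKg. Qed.

Lemma conj_commute (x y : raag G) : x ^ y = x -> commute x y.
Proof. by move=> e; rewrite /commute conjgC e. Qed.

Lemma evalP (x : raag G) : exists t, eval t = x.
Proof.
elim/quotW: x => w; elim: w => [|[v b] w [t et]]; first by exists [::]; exact: eval_nil.
exists (letter_exp (v, b) :: t); rewrite eval_cons et.
have -> : zpow (gen v) (if b then 1 else -1)%R = (\pi_(raag G) [:: (v, b)])%qT.
  case: b => //; exact: (raag_inv_pi [:: (v, true)]).
exact: (raag_mul_pi [:: (v, b)] w).
Qed.

Lemma starword_commute u (t : sword) :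
  all (star u) (gens t) -> commute (gen u) (eval t).
Proof. exact: eval_commute. Qed.

Lemma linkword_star u (t : sword) :
  all (sedge u) (gens t) -> all (star u) (gens t).
Proof. by apply: sub_all => x ux; rewrite /star ux orbT. Qed.

Lemma conj_eval w (t : sword) :
  gen w ^ eval t = eval (sword_inv t ++ (w, 1%R) :: t).
Proof. by rewrite eval_cat eval_cons eval_inv. Qed.

Lemma all_nz_inv (t : sword) :
  all (fun s => s.2 != 0%R) (sword_inv t) = all (fun s => s.2 != 0%R) t.
Proof.
rewrite all_rev all_map; apply: eq_all => s /=; by rewrite oppr_eq0.
Qed.

(** Take a reduced word for [b]; as long as some letter of the star of [w] can be
    moved to its front, move it on into [c].  What remains is [t]. *)
Lemma conj_reduced w (b : raag G) : exists c t : sword,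
  [/\ all (star w) (gens c), b = eval c * eval t
    & reduced (sword_inv t ++ (w, 1%R) :: t)].
Proof.
have [t0 <-] := evalP b.
have [n] := ubnP (size t0); elim: n t0 => // n IHn t0; rewrite ltnS => tn.
have [t [nz um] [<- st _]] := reduce t0.
case: (pselect (exists v m1 m2,
    [/\ gens t = m1 ++ v :: m2, star w v & all (sedge v) m1])) => [|no].
  case=> v [m1 [m2 [/gens_split [t1 [e [t2 [et <- _]]]] wv a1]]].
  have lt : (size (t1 ++ t2) < n)%N.
    apply: leq_trans (leq_trans st tn).
    by rewrite et !size_cat /= addnS.
  have [c [t' [sc ec rt]]] := IHn _ lt.
  exists ((v, e) :: c), t'; split=> //=; first by rewrite wv.
  rewrite eval_cons -mulgA -ec et.
  by rewrite eval_front.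
exists [::], t; split=> //; first by rewrite eval_nil mul1g.
split; first by rewrite all_cat /= all_nz_inv nz.
rewrite /unzip1 map_cat map_cons -/(unzip1 _) -/(unzip1 _) gens_inv /=.
apply: conj_unmergeable => // v m1 m2 em wv; apply/negP => a1.
by apply: no; exists v, m1, m2.
Qed.

(** Let [t] be a reduced word for [x].  The word [v t v^-1] has the same value,
    but two more syllables, so it is not reduced.  Either the two outer letters
    merge, and then all letters of [t] are adjacent to [v], or one of them merges
    with a syllable of [t], which is then split off from [x]. *)
Lemma centralizer v (x : raag G) : commute (gen v) x ->
  exists2 t, all (star v) (gens t) & eval t = x.
Proof.
have [t0 <-] := evalP x.
have [n] := ubnP (size t0); elim: n t0 => // n IHn t0; rewrite ltnS => tn.
have [t [nz um] [<- st _]] := reduce t0 => ct.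
have {tn}st := leq_trans st tn.
have sv : star v v by rewrite /star eqxx.
have cv e : commute (gen v) (zpow (gen v) e : raag G).
  exact: commute_zpow.
pose s := (v, 1%R) :: rcons t (v, -1)%R.
have es : eval t = eval s.
  rewrite /s eval_cons -cats1 eval_cat eval_cons eval_nil mulg1 /=.
  by rewrite mulgA ct mulgK.
have nrs : ~ reduced s.
  move=> rs; have := reduced_size rs (esym es).
  by rewrite /= size_rcons; lia.
case: (nonreducedP nrs) => [[w [t1 [t2 est]]]|].
  have : all (fun s => s.2 != 0%R) s by rewrite /= all_rcons /= nz.
  by rewrite est all_cat /= andbF.
case=> w [e [f [t1 [t2 [t3 [est a2]]]]]].
have IH e' (q : sword) : (size q < n)%N -> eval t = zpow (gen v) e' * eval q \/
    eval t = eval q * zpow (gen v) e' ->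
    exists2 t', all (star v) (gens t') & eval t' = eval t.
  move=> ltq [eq|eq].
    have [|y sy ey] := IHn q ltq.
      by rewrite -(mulKg (zpow (gen v) e') (eval q)) -eq -zpowN; apply: commuteM.
    by exists ((v, e') :: y); rewrite ?eval_cons ?ey //= sv.
  have [|y sy ey] := IHn q ltq.
    by rewrite -(mulgK (zpow (gen v) e') (eval q)) -eq -zpowN; apply: commuteM.
  exists (y ++ [:: (v, e')]); first by rewrite /unzip1 map_cat all_cat sy /= sv.
  by rewrite eval_cat eval_cons eval_nil mulg1 ey.
move: est; rewrite /s; case: t1 => [|l t1]; case/lastP: t3 => [|t3 l'] /=.
- case=> ew _; rewrite cats1 => /rcons_inj [et _].
  exists t => //; rewrite et; move: a2; rewrite -ew; exact: linkword_star.
- case=> ew _; rewrite -rcons_cons -rcons_cat => /rcons_inj [et _].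
  move: a2; rewrite -ew => a2.
  apply: (IH f (t2 ++ t3)); last by left; rewrite et -ew eval_front.
  by apply: leq_trans st; rewrite et !size_cat /= addnS.
- case=> _; rewrite cats1 -rcons_cons -rcons_cat => /rcons_inj [et ww _].
  move: a2; rewrite -ww => a2.
  apply: (IH e (t1 ++ t2)); last by right; rewrite et -ww eval_back.
  by apply: leq_trans st; rewrite et !size_cat /= addnS.
case=> _; rewrite -rcons_cons -rcons_cat -rcons_cons -rcons_cat => /rcons_inj [et _].
have := um w (gens t1) (gens t2) (gens t3).
by rewrite a2 et /unzip1 !(map_cat, map_cons) => /(_ erefl).
Qed.

Lemma linkword_split u (t : sword) : all (star u) (gens t) ->
  exists e t', [/\ all (sedge u) (gens t'), (size t' <= size t)%N
    & eval t = zpow (gen u) e * eval t'].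
Proof.
elim: t => [_|[x f] t IHt /= /andP[ux /IHt [e [t' [lt st et]]]]].
  by exists 0%R, [::]; rewrite mul1g.
have [xu|nxu] := eqVneq x u.
  exists (f + e)%R, t'; split=> //; first exact: leqW.
  by rewrite eval_cons et xu zpowD mulgA.
move: ux; rewrite /star (negbTE nxu) /= => ux.
exists e, ((x, f) :: t'); split=> //=; first by rewrite ux.
rewrite !eval_cons et /= !mulgA; congr (_ * _).
apply: commute_sym; apply: commute_zpow; apply: commute_sym.
by apply: commute_zpow; apply: gen_commute; rewrite sedge_sym.
Qed.

Lemma eval_gen (v : G) : eval [:: (v, 1%R)] = gen v.
Proof. by rewrite eval_cons eval_nil mulg1. Qed.

(** In a reduced word [t^-1 w t] the letter [w] occurs, so it occurs in every
    other word for the same element. *)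
Lemma gen_conj_inj (v w : G) (b : raag G) : gen v = gen w ^ b -> v = w.
Proof.
have [c [t [sc -> rt]]] := conj_reduced w b.
rewrite conjgM (commute_conj (starword_commute sc)) conj_eval => e.
rewrite -eval_gen in e; have h := reduced_support rt (esym e).
apply/esym/eqP; rewrite -(mem_seq1 w v); apply: h.
by rewrite /unzip1 map_cat mem_cat map_cons inE eqxx orbT.
Qed.

Lemma gen_conj_eq (v w : G) (b c : raag G) : gen v ^ b = gen w ^ c ->
  v = w /\ commute (gen v) (b * c^-1).
Proof.
move=> e; have vw : v = w.
  by apply: (@gen_conj_inj v w (c * b^-1)); rewrite conjgM -e conjgK.
by split=> //; apply: conj_commute; rewrite conjgM e -vw conjgK.
Qed.

(** By [conj_reduced] the conjugate is the value of a reduced word [t^-1 w t].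
    This element centralizes [v], so all letters of that word are in the star of
    [v], and the powers of [v] in [t] do not contribute to the conjugate. *)
Lemma commute_gen_conj (v w : G) (b : raag G) :
  commute (gen v) (gen w ^ b) -> gen v <> gen w ^ b ->
  sedge v w /\ exists2 t, all (sedge v) (gens t) & gen w ^ b = gen w ^ eval t.
Proof.
have [c [t [sc -> rt]]] := conj_reduced w b.
rewrite conjgM (commute_conj (starword_commute sc)) => ct ne.
have [s ss es] := centralizer ct.
rewrite conj_eval in es; have sup := reduced_support rt (esym es).
have vsup x : x \in gens (sword_inv t ++ (w, 1%R) :: t) -> star v x.
  by move=> /sup; apply/allP.
have vw : star v w.
  by apply: vsup; rewrite /unzip1 map_cat mem_cat map_cons inE eqxx orbT.
have vt : all (star v) (gens t).
  apply/allP => x xt; apply: vsup.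
  by rewrite /unzip1 map_cat mem_cat map_cons inE xt !orbT.
move: vw; rewrite /star; case: eqP => [ewv|_ /= vw].
  by case: ne; rewrite ewv (commute_conj (starword_commute vt)).
split=> //; have [e [t' [lt _ ->]]] := linkword_split vt.
exists t' => //; rewrite conjgM; congr (_ ^ _); apply: commute_conj.
by apply/commute_zpow/gen_commute; rewrite sedge_sym.
Qed.

(** * Subgroups of links and syllable length *)

Lemma link_groupP (u : G) (x : raag G) :
  link_group u x <-> exists2 t, all (sedge u) (gens t) & eval t = x.
Proof.
split=> [|[t lt <-]].
  elim=> {x}[x [w uw ->]||x y _ [s ls <-] _ [t lt <-]|x _ [t lt <-]].
  - by exists [:: (w, 1%R)]; rewrite /= ?uw // eval_gen.
  - by exists [::] => //; exact: eval_nil.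
  - by exists (s ++ t); rewrite ?eval_cat // /unzip1 map_cat all_cat ls.
  - by exists (sword_inv t); rewrite ?eval_inv // gens_inv all_rev.
elim: t lt => [_|[w e] t IHt /= /andP[uw /IHt lt]].
  by rewrite eval_nil; exact: subgroup_gen_one.
rewrite eval_cons; apply: subgroup_gen_mul lt.
have wn n : link_group u (gen w ^+ n : raag G).
  elim: n => [|n IHn]; first exact: subgroup_gen_one.
  by rewrite expgS; apply: subgroup_gen_mul IHn; apply: subgroup_gen_in; exists w.
by case: e => n /=; [|apply: subgroup_gen_inv]; apply: wn.
Qed.

Lemma syllable_zpow (v : G) e : syllable (zpow (gen v) e : raag G).
Proof.
exists v; have vn n : subgroup_gen (fun y => y = gen v) (gen v ^+ n : raag G).
  elim: n => [|n IHn]; first exact: subgroup_gen_one.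
  by rewrite expgS; apply: subgroup_gen_mul IHn; apply: subgroup_gen_in.
by case: e => n /=; [|apply: subgroup_gen_inv]; apply: vn.
Qed.

Lemma syllableP (x : raag G) : syllable x -> exists s, x = eval [:: s].
Proof.
case=> v; have e1 e : eval [:: (v, e)] = zpow (gen v) e.
  by rewrite eval_cons eval_nil mulg1.
suff h : subgroup_gen (fun y => y = gen v) x -> exists e, x = zpow (gen v) e.
  by move=> /h [e ->]; exists (v, e).
elim=> {x}[x ->||x y _ [e ->] _ [f ->]|x _ [e ->]].
- by exists 1%R.
- by exists 0%R.
- by exists (e + f)%R; rewrite zpowD.
- by exists (- e)%R; rewrite zpowN.
Qed.

Lemma natmin_le (P : nat -> Prop) n : P n -> natmin P <= n.
Proof.
move=> Pn; rewrite /natmin; case: pselect => [exP|[]]; last first.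
  by exists n; apply/asboolP.
by case: ex_minnP => m _; apply; apply/asboolP.
Qed.

Lemma natminP (P : nat -> Prop) : (exists n, P n) -> P (natmin P).
Proof.
move=> [n Pn]; rewrite /natmin; case: pselect => [exP|[]]; last first.
  by exists n; apply/asboolP.
by case: ex_minnP => m /asboolP.
Qed.

Lemma eval_syllables (t : sword) : let s := [seq eval [:: x] | x <- t] in
  [/\ size s = size t, (forall y, y \in s -> syllable y)
    & \prod_(y <- s) y = eval t].
Proof.
split; first by rewrite size_map.
  move=> y /mapP [[v e] _ ->]; rewrite eval_cons eval_nil mulg1.
  exact: syllable_zpow.
by rewrite big_map; apply: eq_bigr => x _; rewrite eval_cons eval_nil mulg1.
Qed.

Lemma syl_length_eval (t : sword) : syl_length (eval t) <= size t.
Proof.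
by apply: natmin_le; exists [seq eval [:: x] | x <- t]; apply: eval_syllables.
Qed.

Lemma syl_lengthP (x : raag G) : exists2 t, eval t = x & size t = syl_length x.
Proof.
have : exists k s, [/\ size s = k, (forall y, y \in s -> syllable y)
    & \prod_(y <- s) y = x].
  have [t <-] := evalP x; exists (size t), [seq eval [:: y] | y <- t].
  exact: eval_syllables.
move=> /natminP [s []]; rewrite -/(syl_length x) => <- + <-.
elim: s => [_|y s IHs ys]; first by exists [::] => //; rewrite eval_nil big_nil.
have [t et st] := IHs (fun z zs => ys z (mem_behead (s := y :: s) zs)).
have [l el] := syllableP (ys y (mem_head _ _)).
exists (l :: t); last by rewrite /= st.
by rewrite -cat1s eval_cat -el et big_cons.
Qed.

End Centralizers.

(** * Walks and the graph metric *)

Section Walks.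
Variables (T : Type) (adj : T -> T -> Prop).

Definition walk (n : nat) (x y : T) : Prop :=
  exists p, [/\ edge_path adj n p, p 0 = x & p n = y].

Lemma walk0 x : walk 0 x x.
Proof. by exists (fun=> x). Qed.

Lemma walk0_eq x y : walk 0 x y -> x = y.
Proof. by case=> p [_ <- <-]. Qed.

Lemma walk_cons n x y z : adj x y -> walk n y z -> walk n.+1 x z.
Proof.
move=> xy [p [ep p0 pn]]; exists (fun i => if i is j.+1 then p j else x).
split=> // -[_|i ni]; first by rewrite p0.
exact: ep.
Qed.

Lemma walk_consP n x z : walk n.+1 x z -> exists2 y, adj x y & walk n y z.
Proof.
case=> p [ep <- <-]; exists (p 1); first exact: ep.
by exists (fun i => p i.+1); split=> // i ni; apply: ep.
Qed.

Lemma walk_cat m n x y z : walk m x y -> walk n y z -> walk (m + n) x z.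
Proof.
elim: m x => [|m IHm] x; first by move=> /walk0_eq ->.
by case/walk_consP => x' xx' /IHm h /h; apply: walk_cons.
Qed.

Lemma walk_sym n x y : (forall a b, adj a b -> adj b a) ->
  walk n x y -> walk n y x.
Proof.
move=> sym [p [ep <- <-]]; exists (fun i => p (n - i)).
split; rewrite ?subn0 ?subnn // => i ni; apply: sym.
by rewrite -(subnSK ni); apply: ep; rewrite subnSK // leq_subr.
Qed.

Lemma edge_path_walk l p i j : edge_path adj l p -> i <= j -> j <= l ->
  walk (j - i) (p i) (p j).
Proof.
move=> ep ij jl; exists (fun k => p (i + k)); rewrite addn0 subnKC //.
by split=> // k ki; rewrite addnS; apply: ep; lia.
Qed.

Lemma gdist_le n x y : walk n x y -> gdist adj x y <= n.
Proof. exact: natmin_le. Qed.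

Lemma gdistP n x y : walk n x y -> walk (gdist adj x y) x y.
Proof. by move=> w; apply: (@natminP (fun m => walk m x y)); exists n. Qed.

(** A shorter walk between two points of a geodesic would shorten the whole. *)
Lemma gdist_geodesic l p i j : edge_path adj l p -> gdist adj (p 0) (p l) = l ->
  i <= j -> j <= l -> gdist adj (p i) (p j) = j - i.
Proof.
move=> ep gl ij jl; have wij := edge_path_walk ep ij jl.
have w1 := edge_path_walk ep (leq0n i) (leq_trans ij jl).
have w2 := edge_path_walk ep jl (leqnn l).
have := gdist_le (walk_cat (walk_cat w1 (gdistP wij)) w2).
by rewrite gl; have := gdist_le wij; lia.
Qed.

End Walks.

Lemma walk_map (T T' : Type) adj adj' (f : T -> T') n x y :
  (forall a b, adj a b -> adj' (f a) (f b)) ->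
  walk adj n x y -> walk adj' n (f x) (f y).
Proof.
move=> hf [p [ep <- <-]]; exists (fun i => f (p i)).
by split=> // i ni; apply/hf/ep.
Qed.

Lemma gdist_sym (T : Type) (adj : T -> T -> Prop) n x y :
  (forall a b, adj a b -> adj b a) -> walk adj n x y ->
  gdist adj x y = gdist adj y x.
Proof.
move=> sym wxy; have wyx := walk_sym sym wxy.
apply/eqP; rewrite eqn_leq.
rewrite (gdist_le (walk_sym sym (gdistP wyx))).
by rewrite (gdist_le (walk_sym sym (gdistP wxy))).
Qed.

(** Each point of a hair is within [k], in the metric and in the parameter, of a
    point of the geodesic. *)
Lemma hair_quasi_geodesic (T : Type) (adj : T -> T -> Prop) k l p i j :
  (forall a b, adj a b -> adj b a) -> edge_path adj (k + l + k) p ->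
  gdist adj (p k) (p (k + l)) = l -> i <= j -> j <= k + l + k ->
  j - i <= gdist adj (p i) (p j) + 4 * k.
Proof.
move=> sym ep gl ij jl.
have [i' [ni [wi ni1 ni2]]] : exists i' n, [/\ walk adj n (p (k + i')) (p i),
    n <= k & (i' <= l) && (k + i' <= i + k) && (i <= k + i' + k)].
  case: (leqP i k) => ik.
    exists 0, (k - i); split; [|lia|lia].
    by rewrite addn0; apply: walk_sym sym _; apply: (edge_path_walk ep); lia.
  case: (leqP i (k + l)) => il.
    exists (i - k), 0; rewrite subnKC; last lia.
    by split; [exact: walk0|lia|lia].
  exists l, (i - (k + l)); split; [|lia|lia].
  by apply: (edge_path_walk ep); lia.
have [j' [nj [wj nj1 nj2]]] : exists i' n, [/\ walk adj n (p j) (p (k + i')),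
    n <= k & (i' <= l) && (k + i' <= j + k) && (j <= k + i' + k)].
  case: (leqP j k) => jk.
    exists 0, (k - j); split; [|lia|lia].
    by rewrite addn0; apply: (edge_path_walk ep); lia.
  case: (leqP j (k + l)) => jl'.
    exists (j - k), 0; rewrite subnKC; last lia.
    by split; [exact: walk0|lia|lia].
  exists l, (j - (k + l)); split; [|lia|lia].
  by apply: walk_sym sym _; apply: (edge_path_walk ep); lia.
have [i'j'|j'i'] := leqP i' j'; last by lia.
have wij := gdistP (edge_path_walk ep ij jl).
have := gdist_le (walk_cat (walk_cat wi wij) wj).
pose q m := p (k + m).
have eq : edge_path adj l q.
  by move=> m ml; rewrite /q addnS; apply: ep; lia.
have := @gdist_geodesic T adj l q i' j' eq _ i'j' _.
rewrite /q addn0 => -> //; lia.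
Qed.

(** * Metrics on links *)

Section Links.
Variable G : sgraph.
Local Notation sword := (seq (G * int)).
Local Notation gens := (@unzip1 G int).
Local Open Scope group_scope.

Lemma triangleP (u w x : G) : triangle_free G ->
  sedge u w -> sedge w x -> sedge u x -> False.
Proof.
move=> tf uw wx ux; apply: tf.
have wu : sedge w u by rewrite sedge_sym.
have xw : sedge x w by rewrite sedge_sym.
have xu : sedge x u by rewrite sedge_sym.
have nuw : u != w by apply: contraTneq uw => ->; rewrite sedge_irrefl.
have nwx : w != x by apply: contraTneq wx => ->; rewrite sedge_irrefl.
have nux : u != x by apply: contraTneq ux => ->; rewrite sedge_irrefl.
exists (fun i : 'I_3 => nth u [:: u; w; x] i).
  move=> i j /eqP; rewrite nth_uniq // ?ltn_ord //; first by move/eqP/val_inj.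
  by rewrite /= !inE negb_or nuw nux nwx.
move=> [[|[|[|//]]] ilt] [[|[|[|//]]] jlt] /=.
all: by rewrite ?sedge_irrefl ?uw ?wx ?ux ?wu ?xw ?xu.
Qed.

Lemma eval_power (w : G) (t : sword) : all (fun x => x == w) (gens t) ->
  exists e, eval t = zpow (gen w) e.
Proof.
elim: t => [_|[x f] t IHt /= /andP[/eqP -> /IHt [e et]]].
  by exists 0%R; rewrite eval_nil.
by exists (f + e)%R; rewrite eval_cons et zpowD.
Qed.

(** A letter different from [w] that is in the star of [w] and in the link of [u]
    would form a triangle with [u] and [w]. *)
Lemma link_power (u w : G) (x : raag G) : triangle_free G -> sedge u w ->
  commute (gen w) x -> link_group u x -> exists e, x = zpow (gen w) e.
Proof.
move=> tf uw /centralizer [s ss es] /link_groupP [q lq eq].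
have [t rt [et _ ts]] := reduce q.
rewrite -eq -et; apply: eval_power; apply/allP => y yt.
have uy : sedge u y by apply: (allP lq); apply: ts.
have ets : eval t = eval s by rewrite et es eq.
have := allP ss _ (reduced_support rt ets yt).
by rewrite /star; case: eqP => //= _ wy; case: (triangleP tf uw wy uy).
Qed.

Lemma conj_zpow_link (u y : G) e (x : raag G) : sedge u y ->
  gen y ^ (zpow (gen u) e * x) = gen y ^ x.
Proof.
move=> uy; rewrite conjgM; congr (_ ^ _); apply: commute_conj.
by apply/commute_zpow/gen_commute; rewrite sedge_sym.
Qed.

Lemma conj_zpow_self (y : G) e (x : raag G) :
  gen y ^ (zpow (gen y) e * x) = gen y ^ x.
Proof.
by rewrite conjgM; congr (_ ^ _); apply: commute_conj; apply/commute_zpow.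
Qed.

Lemma link_step (u w w' : G) (f : raag G) : sedge u w -> sedge u w' ->
  link_group u f ->
  exists2 n, (n <= 1)%N & walk (link_adj u) n (gen w ^ f) (gen w' ^ f).
Proof.
move=> uw uw' lf; have [->|/eqP ne] := eqVneq (gen w ^ f) (gen w' ^ f).
  by exists 0%N => //; exact: walk0.
exists 1%N => //; apply: walk_cons (walk0 _ _); split=> //.
by exists w, w', f.
Qed.

Lemma link_group_eval (u : G) (t : sword) : all (sedge u) (gens t) ->
  link_group u (eval t).
Proof. by move=> lt; apply/link_groupP; exists t. Qed.

(** Spell [t] one syllable at a time: for a syllable [a^e] at the front, the walk
    first moves to the conjugate of [a] by [f], which does not change when [a^e]
    is removed from [f]. *)
Lemma link_walk (u w w' : G) (t : sword) (f f' : raag G) :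
  sedge u w -> sedge u w' -> all (sedge u) (gens t) ->
  link_group u f' -> f = eval t * f' ->
  exists2 n, (n <= size t + 1)%N &
    walk (link_adj u) n (gen w ^ f) (gen w' ^ f').
Proof.
move=> + uw' + lf'; elim: t w f => [|[a e] t IHt] w f uw.
  by move=> _; rewrite eval_nil mul1g => ->; apply: link_step.
move=> at_ ef; have /= /andP[ua lt] := at_.
have lf : link_group u f.
  by rewrite ef; apply: subgroup_gen_mul lf'; apply: link_group_eval.
have [n1 h1 w1] := link_step uw ua lf.
have [n2 h2 w2] := IHt a (eval t * f') ua lt erefl.
exists (n1 + n2)%N; first by rewrite /=; lia.
apply: walk_cat w1 _; rewrite ef eval_cons -mulgA /=.
by rewrite conj_zpow_self.
Qed.

(** Each vertex of the walk is written in two ways as a conjugate of a generator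
    [w], once for each edge at it, and the two conjugators differ by an element
    that centralizes [w], which is a syllable by [link_power]. *)
Lemma link_walk_inv n (u w w' : G) (f f' : raag G) : triangle_free G ->
  sedge u w -> sedge u w' -> link_group u f -> link_group u f' ->
  walk (link_adj u) n (gen w ^ f) (gen w' ^ f') ->
  exists2 t : sword, (size t <= n.+1)%N & eval t = f * f'^-1.
Proof.
move=> tf + uw' + lf'; elim: n w f => [|n IHn] w f uw lf.
  move=> wk; have [_ c] := gen_conj_eq (walk0_eq wk).
  have [|e ->] := link_power tf uw c.
    by apply: subgroup_gen_mul lf _; apply: subgroup_gen_inv.
  by exists [:: (w, e)] => //; rewrite eval_cons eval_nil mulg1.
move=> wk0; case: (walk_consP wk0) => x [_ [w1 [w2 [h [uw1 uw2 lh e1 ->]]]]] wk.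
have [t st et] := IHn w2 h uw2 lh wk.
have [_ c] := gen_conj_eq e1.
have [|e ee] := link_power tf uw c.
  by apply: subgroup_gen_mul lf _; apply: subgroup_gen_inv.
by exists ((w, e) :: t) => //; rewrite eval_cons et /= -ee mulgA mulgVK.
Qed.

(** Neighbours of [u] only see the component of [c] in the subgroup generated by
    the link of [u]. *)
Lemma link_coord (u : G) (c : raag G) : commute (gen u) c ->
  exists e s, [/\ all (sedge u) (gens s), c = zpow (gen u) e * eval s
    & forall y, sedge u y -> gen y ^ c^-1 = gen y ^ eval (sword_inv s)].
Proof.
move=> /centralizer [t st <-]; have [e [s [ls _ es]]] := linkword_split st.
exists e, s; split=> // y uy; rewrite es.
rewrite (commute_sym (zpow_commute e ls)) invgM -zpowN eval_inv.
exact: conj_zpow_link.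
Qed.

(** A vertex [x] of the extension graph, conjugate of [u] both by the inverse of
    [P] and by that of [P * eval t], with a neighbour given in each of the two
    frames. *)
Section LinkDistance.
Variables (u y z : G) (P : raag G) (t : sword).
Hypotheses (uy : sedge u y) (uz : sedge u z) (st : all (star u) (gens t)).

Let d := link_dist (gen u ^ P^-1) (gen y ^ P^-1) (gen z ^ (P * eval t)^-1).

Lemma link_dist_le : (d <= size t + 1)%N.
Proof.
have [e [s [ls ss es]]] := linkword_split st.
have [n ns wk] : exists2 n, (n <= size s + 1)%N &
    walk (link_adj u) n ((gen y ^ P^-1) ^ P^-1^-1)
      ((gen z ^ (P * eval t)^-1) ^ P^-1^-1).
  rewrite -!conjgM invgK mulVg invgM mulgVK es.
  rewrite (commute_sym (zpow_commute e ls)) invgM -zpowN conj_zpow_link //.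
  apply: link_walk => //; last by rewrite mulgV.
  by apply: subgroup_gen_inv; apply: link_group_eval.
have : (d <= gdist (link_adj u) ((gen y ^ P^-1) ^ P^-1^-1)%g
      ((gen z ^ (P * eval t)^-1) ^ P^-1^-1)%g)%N.
  by apply: natmin_le; exists u, P^-1.
by have := gdist_le wk; lia.
Qed.

(** The metric of the link of [x] is defined through some presentation of [x] as a
    conjugate [u^h].  Whichever presentation realizes the minimum, in the
    coordinates of that presentation the distance is the length of an actual
    walk. *)
Lemma link_distP : exists e1 e2 s1 s2 h,
  [/\ all (sedge u) (gens s1), all (sedge u) (gens s2),
      h * P = zpow (gen u) e1 * eval s1,
      h * (P * eval t) = zpow (gen u) e2 * eval s2
    & [/\ (gen y ^ P^-1) ^ h^-1 = gen y ^ eval (sword_inv s1),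
        (gen z ^ (P * eval t)^-1) ^ h^-1 = gen z ^ eval (sword_inv s2)
      & walk (link_adj u) d (gen y ^ eval (sword_inv s1))
                            (gen z ^ eval (sword_inv s2))]].
Proof.
have [u' [h [eh dh]]] : exists u' h, gen u ^ P^-1 = gen u' ^ h /\
    d = gdist (link_adj u') ((gen y ^ P^-1) ^ h^-1)
          ((gen z ^ (P * eval t)^-1) ^ h^-1).
  apply: (@natminP (fun n => exists u' h, _ /\ n = _)).
  by eexists _, u, P^-1; split.
have [eu c] := gen_conj_eq eh; rewrite -eu {eh} in dh.
have c1 : commute (gen u) (h * P).
  by rewrite -[h * P]invgK invgM; apply: commuteV.
have c2 : commute (gen u) (h * (P * eval t)).
  by rewrite mulgA; apply: commuteM c1 (starword_commute st).
have [e1 [s1 [l1 eq1 j1]]] := link_coord c1.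
have [e2 [s2 [l2 eq2 j2]]] := link_coord c2.
exists e1, e2, s1, s2, h; split=> //.
have k1 : (gen y ^ P^-1) ^ h^-1 = gen y ^ eval (sword_inv s1).
  by rewrite -j1 // invgM conjgM.
have k2 : (gen z ^ (P * eval t)^-1) ^ h^-1 = gen z ^ eval (sword_inv s2).
  by rewrite -j2 // (invgM h) conjgM.
split=> //; rewrite dh k1 k2.
have [|||n _ wk] := @link_walk u y z (sword_inv s1 ++ s2)
    (eval (sword_inv s1)) (eval (sword_inv s2)) uy uz.
- by rewrite /unzip1 map_cat all_cat -/(gens _) -/(gens _) gens_inv all_rev l1.
- by apply: link_group_eval; rewrite gens_inv all_rev.
- by rewrite eval_cat -mulgA !eval_inv mulgV mulg1.
exact: gdistP wk.
Qed.

(** The factor [s1^-1 s2] of [eval t] is spelled by a shortest walk in the link,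
    and the rest of [eval t] is one syllable, a power of [u]. *)
Lemma link_dist_ge : triangle_free G -> (syl_length (eval t) <= d + 2)%N.
Proof.
move=> tf; have [e1 [e2 [s1 [s2 [h [l1 l2 eq1 eq2 [_ _ wk]]]]]]] := link_distP.
have li s : all (sedge u) (gens s) -> link_group u (eval (sword_inv s)).
  by move=> ls; apply: link_group_eval; rewrite gens_inv all_rev.
have [q sq eq] := link_walk_inv tf uy uz (li _ l1) (li _ l2) wk.
have -> : eval t = eval ((u, e2 - e1)%R :: q).
  rewrite eval_cons eq !eval_inv invgK /=.
  have -> : eval t = (h * P)^-1 * (h * (P * eval t)).
    by rewrite (mulgA h) mulKg.
  have c := commuteV (commute_sym (zpow_commute (e2 - e1)%R l1)).
  have z12 : zpow (gen u) (e2 - e1)%R = (zpow (gen u) e1)^-1 * zpow (gen u) e2.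
    by rewrite addrC zpowD zpowN.
  by rewrite [RHS]mulgA c z12 eq1 eq2 invgM !mulgA.
apply: leq_trans (syl_length_eval _) _; rewrite /=; lia.
Qed.

Lemma link_dist0 : d = 0%N -> gen y ^ P^-1 = gen z ^ (P * eval t)^-1.
Proof.
have [e1 [e2 [s1 [s2 [h [_ _ _ _ [k1 k2 wk]]]]]]] := link_distP.
move=> d0; rewrite d0 in wk; have e := walk0_eq wk.
by apply: (@conjg_inj _ h^-1); rewrite k1 k2.
Qed.

End LinkDistance.
End Links.

(** * Walks in the extension graph *)

Section ExtensionGraphWalks.
Variable G : sgraph.
Local Notation sword := (seq (G * int)).
Local Notation gens := (@unzip1 G int).
Local Open Scope group_scope.

Lemma ext_adj_sym (x y : raag G) : ext_adj x y -> ext_adj y x.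
Proof.
by case=> vx vy ne c; split=> // e; apply: ne.
Qed.

Lemma ext_adj_conj (x y b : raag G) : ext_adj x y -> ext_adj (x ^ b) (y ^ b).
Proof.
case=> [[v [h ->]] [w [k ->]] ne c]; split.
- by exists v, (h * b); rewrite conjgM.
- by exists w, (k * b); rewrite conjgM.
- by move/conjg_inj.
by rewrite /commute -[LHS]conjMg -[RHS]conjMg c.
Qed.

Lemma gen_adj (u w : G) : sedge u w -> ext_adj (gen u) (gen w).
Proof.
move=> uw; split.
- by exists u, 1; rewrite conjg1.
- by exists w, 1; rewrite conjg1.
- rewrite -[gen w]conjg1 => /gen_conj_inj e.
  by rewrite e sedge_irrefl in uw.
exact: gen_commute.
Qed.

(** Any edge at [u^(P^-1)] is a conjugate of an edge at [u]. *)
Lemma ext_adj_frame (u : G) (P y : raag G) : ext_adj (gen u ^ P^-1) y ->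
  exists w (R : raag G),
    [/\ sedge u w, gen u ^ P^-1 = gen u ^ R^-1 & y = gen w ^ R^-1].
Proof.
case=> _ [w [k ->]] ne c.
have ek : (gen w ^ (k * P)) ^ P^-1 = gen w ^ k by rewrite conjgM conjgK.
have [||uw [t lt et]] := @commute_gen_conj G u w (k * P).
- apply: (@conjg_inj _ P^-1); rewrite /= (conjMg (gen u)) (conjMg _ (gen u)) ek; exact: c.
- by move=> e; apply: ne; rewrite e ek.
exists w, (P * (eval t)^-1); split=> //; rewrite invgM invgK conjgM.
  by rewrite [gen u ^ eval t]commute_conj //; apply/starword_commute/linkword_star.
by rewrite -et ek.
Qed.

Definition walk_le (n : nat) (x y : raag G) : Prop :=
  exists2 m, (m <= n)%N & walk (@ext_adj G) m x y.

Lemma graph_walk (v w : G) : connected_graph G ->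
  walk_le (diam G) (gen v) (gen w).
Proof.
move=> conn; exists (gdist (@sedge G) v w).
  by apply: leq_trans (leq_bigmax v); apply: (leq_bigmax w).
apply: (walk_map (adj := @sedge G)); first exact: gen_adj.
have /connectP [p] := conn v w.
elim: p v => [|x p IHp] v /=; first by move=> _ ->; exact: gdistP (walk0 _ _).
case/andP=> vx px lx; apply: gdistP; apply: walk_cons vx _; exact: IHp px lx.
Qed.

(** A syllable [a^e] is crossed at no cost at its generator [a], which it fixes;
    between two such generators the walk runs inside a conjugate of the graph. *)
Lemma ext_walk (t : sword) (v w : G) : connected_graph G ->
  walk_le (diam G * (size t + 1)) (gen v) (gen w ^ (eval t)^-1).
Proof.
move=> conn; elim: t v => [|[a e] t IHt] v.
  by rewrite eval_nil invg1 conjg1 add0n muln1; exact: graph_walk.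
have [n hn wn] := graph_walk v a conn; have [m hm wm] := IHt a.
exists (n + m)%N; first by rewrite /= addSn mulnS leq_add.
apply: walk_cat wn _; rewrite eval_cons invgM conjgM /=.
rewrite -[X in walk _ _ X _](_ : gen a ^ (zpow (gen a) e)^-1 = gen a).
  exact: (walk_map (f := fun x => x ^ _) (fun a b => @ext_adj_conj a b _)).
by apply: commute_conj; apply: commuteV; apply: commute_zpow.
Qed.

(** * Walks in the extension graph as lists of star words *)

Local Notation block := (G * sword)%type.
Local Notation flat := (fun bs : seq block => flatten (unzip2 bs)).

Definition star_blocks : pred (seq block) :=
  all (fun b => all (star b.1) (gens b.2)).

(** Consecutive edges of the walk come from conjugates of the graph that share a
    vertex, so their conjugators differ by an element that centralizes the
    corresponding generator. *)
Lemma walk_blocks n (u u' : G) (P Q : raag G) :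
  walk (@ext_adj G) n (gen u ^ P^-1) (gen u' ^ Q^-1) ->
  exists t bs, [/\ size bs = n, path (@sedge G) u (unzip1 bs),
    last u (unzip1 bs) = u', star_blocks ((u, t) :: bs)
    & eval (flat ((u, t) :: bs)) = P^-1 * Q].
Proof.
elim: n u P => [|n IHn] u P.
  move=> wk; have [eu c] := gen_conj_eq (walk0_eq wk).
  have [t st et] := centralizer c; exists t, [::]; split=> //=.
    by rewrite st.
  by rewrite cats0 et invgK.
move=> wk; have [y xy wy] := walk_consP wk.
have [w [R [uw eR ey]]] := ext_adj_frame xy.
rewrite ey in wy; have [t [bs [sz pth lst stb eqb]]] := IHn w R wy.
have [_ c] := gen_conj_eq eR; have [t0 st0 et0] := centralizer c.
exists t0, ((w, t) :: bs); split=> //=.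
- by rewrite sz.
- by rewrite uw.
- by rewrite st0.
by rewrite eval_cat et0 eqb invgK -mulgA mulVKg.
Qed.

Lemma cat_cons_split (T : Type) (s1 s2 a r : seq T) x :
  s1 ++ s2 = a ++ x :: r ->
  (exists2 q, s1 = a ++ x :: q & r = q ++ s2) \/
  (exists2 q, a = s1 ++ q & s2 = q ++ x :: r).
Proof.
elim: s1 a => [|y s1 IHs] a /=; first by move=> ->; right; exists a.
case: a => [|z a] /= [-> e]; first by left; exists s1.
case: (IHs a e) => -[q -> ->]; [left|right]; by exists q.
Qed.

(** Used to delete a syllable, with [y] empty, and to change its exponent. *)
Lemma block_edit bs a x r (y : sword) : star_blocks bs ->
  flat bs = a ++ x :: r -> all (fun s => s.1 == x.1) y ->
  exists bs', [/\ unzip1 bs' = unzip1 bs, star_blocks bs'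
    & flat bs' = a ++ y ++ r].
Proof.
move=> + + yx; elim: bs a => [|[c t] bs IHbs] a /=; first by case: a.
move=> /andP[st sb] e; case: (cat_cons_split e) => [[q et er]|[q ea eb]].
  exists ((c, a ++ y ++ q) :: bs); split=> //=; last first.
    by rewrite er -!catA.
  rewrite sb andbT; move: st; rewrite et /unzip1 !map_cat !all_cat /=.
  case/and3P => -> cx ->; rewrite andbT /= all_map.
  by apply: sub_all yx => s /= /eqP ->.
have [bs' [e1 sb' fb]] := IHbs q sb eb; exists ((c, t) :: bs'); split=> /=.
- by rewrite e1.
- by rewrite st.
by rewrite fb ea -catA.
Qed.

(** When two syllables merge, the second is deleted and the first gets the sum of
    the exponents, which leaves every centre as it was. *)
Lemma blocks_reduce bs : star_blocks bs -> exists bs',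
  [/\ unzip1 bs' = unzip1 bs, star_blocks bs', eval (flat bs') = eval (flat bs)
    & reduced (flat bs')].
Proof.
have [n] := ubnP (size (flat bs)).
elim: n bs => // n IHn bs; rewrite ltnS => sn sb.
have [r|nr] := pselect (reduced (flat bs)); first by exists bs.
suff [b1 [u1 sb1 e1 lt]] : exists b1, [/\ unzip1 b1 = unzip1 bs, star_blocks b1,
    eval (flat b1) = eval (flat bs) & (size (flat b1) < size (flat bs))%N].
  have [b2 [u2 sb2 e2 r2]] := IHn b1 (leq_trans lt sn) sb1.
  by exists b2; split; rewrite ?u2 ?e2.
case: (nonreducedP nr) => [[v [t1 [t2 eb]]]|].
  have [b1 [u1 sb1 e1]] := @block_edit bs t1 (v, 0%R) t2 [::] sb eb isT.
  exists b1; rewrite e1 eb; split=> //.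
    by rewrite /= !eval_cat eval_cons mul1g.
  by rewrite !size_cat /= addnS.
case=> v [e [f [t1 [t2 [t3 [eb a2]]]]]].
have eb' : flat bs = (t1 ++ (v, e) :: t2) ++ (v, f) :: t3.
  by rewrite eb -catA.
have [b1 [u1 sb1 e1]] := @block_edit bs _ _ _ [::] sb eb' isT.
rewrite /= -catA /= in e1.
have [|b2 [u2 sb2 e2]] := @block_edit b1 _ _ _ [:: (v, e + f)%R] sb1 e1.
  by rewrite /= eqxx.
exists b2; rewrite e2 eb; split=> //; first by rewrite u2.
  by rewrite (eval_merge e f t1 t3 a2).
by rewrite !size_cat /= !size_cat /= !addnS.
Qed.

Lemma syl_length_mul (x y : raag G) :
  (syl_length (x * y)%g <= syl_length x + syl_length y)%N.
Proof.
have [s <- <-] := syl_lengthP x; have [t <- <-] := syl_lengthP y.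
by rewrite -eval_cat; apply: leq_trans (syl_length_eval _) _; rewrite size_cat.
Qed.

Lemma syl_length_flatten (ts : seq sword) :
  (syl_length (eval (flatten ts)) <= \sum_(t <- ts) syl_length (eval t))%N.
Proof.
elim: ts => [|t ts IHts]; first by rewrite big_nil; apply: (syl_length_eval [::]).
rewrite big_cons eval_cat; apply: leq_trans (syl_length_mul _ _) _.
by rewrite leq_add2l.
Qed.

Lemma syl_length_inv (x : raag G) : syl_length x^-1 = syl_length x.
Proof.
have le y : (syl_length y^-1%g <= syl_length y)%N.
  have [s <- <-] := syl_lengthP y.
  by rewrite -eval_inv -(size_inv s); apply: syl_length_eval.
by apply/eqP; rewrite eqn_leq le -{1}[x]invgK le.
Qed.

Section BlockPath.
Variables (v v' : G) (bs : seq block).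
Hypotheses (pth : path (@sedge G) v (rcons (unzip1 bs) v')) (sb : star_blocks bs).

Let vtx j := nth v (v :: rcons (unzip1 bs) v') j.
Let word_at k := nth [::] (unzip2 bs) k.
Let prefix j := eval (flatten (take j.-1 (unzip2 bs))).

(** The inverse of [walk_blocks], for a list of blocks whose centres form a walk
    with endpoints [v] and [v'] added.  The vertex at time [j] is conjugated by
    the inverse of the product of the blocks before it; the block at time [j] fixes that
    vertex. *)
Definition block_path (j : nat) : raag G :=
  gen (nth v (v :: rcons (unzip1 bs) v') j)
    ^ (eval (flatten (take j.-1 (unzip2 bs))))^-1.

Lemma prefixS k : (k < size bs)%N -> prefix k.+2 = prefix k.+1 * eval (word_at k).
Proof.
move=> kb; rewrite /prefix /= (take_nth [::]) ?size_map //.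
by rewrite flatten_rcons eval_cat.
Qed.

Lemma vtx_edge j : (j <= size bs)%N -> sedge (vtx j) (vtx j.+1).
Proof.
move=> jb; have /(pathP v) h := pth; rewrite /vtx /=.
by apply: h; rewrite size_rcons size_map.
Qed.

Lemma star_word_at k : (k < size bs)%N -> all (star (vtx k.+1)) (gens (word_at k)).
Proof.
move=> kb; have := all_nthP (v, [::]) sb k kb.
rewrite /vtx /word_at /= nth_rcons size_map kb.
by rewrite (nth_map (v, [::])) // (nth_map (v, [::])).
Qed.

Lemma block_pathS j : (j <= size bs)%N -> block_path j = gen (vtx j) ^ (prefix j.+1)^-1.
Proof.
case: j => [_|k kb]; first by rewrite /block_path /prefix /= take0.
rewrite prefixS // /block_path -/(prefix k.+1) -/(vtx k.+1) invgM conjgM.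
congr (_ ^ _); apply/esym; apply: commute_conj; apply: commuteV.
exact/starword_commute/star_word_at.
Qed.

Lemma block_path_edge : edge_path (@ext_adj G) (size bs).+1 block_path.
Proof.
move=> j jb; rewrite block_pathS //; apply: ext_adj_conj; apply: gen_adj.
exact: vtx_edge.
Qed.

Lemma block_path_link k : (k < size bs)%N ->
  let d := link_dist (block_path k.+1) (block_path k) (block_path k.+2) in
  [/\ (d <= size (word_at k) + 1)%N,
      triangle_free G -> (syl_length (eval (word_at k)) <= d + 2)%N
    & block_path k <> block_path k.+2 -> (0 < d)%N].
Proof.
move=> kb /=; rewrite (block_pathS (ltnW kb)).
have e1 : sedge (vtx k.+1) (vtx k) by rewrite sedge_sym; apply: vtx_edge (ltnW kb).
have e2 := vtx_edge kb; have sw := star_word_at kb.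
have -> : block_path k.+1 = gen (vtx k.+1) ^ (prefix k.+1)^-1 by [].
have -> : block_path k.+2 =
    gen (vtx k.+2) ^ (prefix k.+1 * eval (word_at k))^-1 by rewrite -prefixS.
split; [exact: link_dist_le | exact: link_dist_ge | move=> ne].
rewrite lt0n; apply/eqP => d0; apply: ne.
exact: link_dist0 d0.
Qed.

End BlockPath.
End ExtensionGraphWalks.

(** * The quasi-geodesic *)

Lemma asymp_nat (k A B : nat) : 0 < k -> B <= k * (A + k) -> A <= k * B + k ->
  asymp k%:R%R k%:R%R A%:R%R B%:R%R.
Proof.
move=> k0 h1 h2; split; last by rewrite -natrM -natrD ler_nat.
rewrite lerBlDr ler_pdivrMl ?ltr0n //.
by rewrite -natrD -natrM ler_nat.
Qed.

Lemma sum_eq_le N a : \sum_(i < N) (i == a :> nat) <= 1.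
Proof.
suff : \sum_(i < N) (i == a :> nat) <= (a < N) by case: (a < N) => //; lia.
elim: N => [|N IHN]; first by rewrite big_ord0.
rewrite big_ord_recr /=; apply: leq_trans (leq_add IHN (leqnn _)) _.
by rewrite ltnS; case: (ltngtP N a).
Qed.

(** In a connected graph without edges all vertices coincide. *)
Lemma exists_edge (G : sgraph) : connected_graph G -> 0 < diam G ->
  exists v w : G, sedge v w.
Proof.
move=> conn d0; apply: contrapT => no; move: d0; rewrite lt0n => /negP; apply.
rewrite -leqn0; apply/bigmax_leqP => x _; apply/bigmax_leqP => y _.
have /connectP [[|z p] /=] := conn x y.
  by move=> _ ->; apply: gdist_le; exact: walk0.
by case/andP=> xz; case: no; exists x, z.
Qed.

Lemma sum_size_nth (T : Type) (ts : seq (seq T)) n : n = size ts ->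
  \sum_(k < n) size (nth [::] ts k) = size (flatten ts).
Proof.
by move=> ->; rewrite size_flatten sumnE big_map (big_nth [::]) big_mkord.
Qed.

Theorem proposition65 (G : sgraph) (hconn : connected_graph G)
    (htri : triangle_free G) (hsq : square_free G)
    (hdiam : (2 <= diam G)%N) (g : raag G) (hg : g <> 1%g) :
  let K : rat := ((10 * diam G)%N%:R)%R in
  exists (l : nat) (gamma : nat -> raag G) (v : G),
    [/\ edge_path (@ext_adj G) l gamma,
        quasi_geodesic (@ext_adj G) K K l gamma,
        gamma 0%N = gen v,
        gamma l = (gen v ^ g)%g
      & asymp K K
          ((\sum_(1 <= i < l)
              link_dist (gamma i) (gamma i.-1) (gamma i.+1))%N%:R)%R
          ((syl_length g)%:R)%R].
Proof.
move=> K; rewrite {}/K; set D := diam G in hdiam *.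
have [v [w vw]] : exists v w : G, sedge v w by apply: exists_edge => //; exact: ltnW.
have wv : sedge w v by rewrite sedge_sym.
have [t et] := syl_lengthP g^-1%g; rewrite syl_length_inv => st.
have [m hm] := ext_walk t v v hconn; rewrite et invgK => wk0.
rewrite st -/D in hm.
have := gdistP wk0; have := leq_trans (gdist_le wk0) hm.
set l := gdist _ _ _ => hl; rewrite -[in X in walk _ _ X _](conjg1 (gen v)).
rewrite -{1}[g]invgK -{1}invg1 => /walk_blocks [t0 [bs0 [sz0 p0 l0 sb0 e0]]].
have [bs [eu sb]] := blocks_reduce sb0; rewrite e0 invg1 mul1g => ebs rbs.
have szflat : size (flatten (unzip2 bs)) <= syl_length g.
  by rewrite -st; apply: reduced_size rbs _; rewrite ebs et.
have szbs : size bs = l.+1 by have := congr1 size eu; rewrite /= !size_map sz0.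
(* The hairs: the blocks at [w] are empty, and [block_path] adds the endpoints. *)
pose BS := (w, [::]) :: rcons bs (w, [::]).
have szBS : size BS = l + 3 by rewrite /= size_rcons szbs; lia.
have uBS : unzip1 BS = w :: rcons (v :: unzip1 bs0) w.
  by rewrite /BS /unzip1 /= map_rcons [map _ bs]eu.
have pBS : path (@sedge G) v (rcons (unzip1 BS) v).
  by rewrite uBS /= vw wv !rcons_path p0 last_rcons l0 vw wv.
have sBS : star_blocks BS by rewrite /star_blocks /= all_rcons.
have fBS : flatten (unzip2 BS) = flatten (unzip2 bs).
  by rewrite /unzip2 /= map_rcons flatten_rcons cats0.
pose gam := block_path v v BS.
have epath : edge_path (@ext_adj G) (l + 4) gam.
  have -> : l + 4 = (size BS).+1 by rewrite szBS; lia.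
  exact: block_path_edge.
have g0 : gam 0 = gen v.
  by rewrite /gam /block_path /= eval_nil invg1 conjg1.
have g2 : gam 2 = gen v.
  by rewrite /gam /block_path uBS /= take0 /= eval_nil invg1 conjg1.
have gl2 : gam (l + 2) = (gen v ^ g)%g.
  rewrite /gam (@block_pathS G v v BS sBS); last by rewrite szBS; lia.
  have -> : nth v (v :: rcons (unzip1 BS) v) (l + 2) = v.
    rewrite uBS addn2 /= -2!rcons_cons 2!nth_rcons /= size_rcons size_map sz0.
    by rewrite leqnSn ltnSn -[RHS]l0 (last_nth v) /= size_map sz0.
  rewrite addn2 /= /unzip2 map_rcons -cats1 take_size_cat.
    by rewrite -/(unzip2 _) ebs invgK.
  by rewrite size_map szbs.
have gl4 : gam (l + 4) = (gen v ^ g)%g.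
  rewrite /gam /block_path take_oversize; last by rewrite size_map szBS; lia.
  rewrite fBS ebs invgK; congr (gen _ ^ _)%g.
  have -> : l + 4 = (l + 3).+1 by lia.
  rewrite -[nth _ _ _]/(nth v (rcons (unzip1 BS) v) (l + 3)).
  by rewrite nth_rcons size_map szBS ltnn eqxx.
have geo : gdist (@ext_adj G) (gam 2) (gam (2 + l)) = l.
  by rewrite g2 addnC gl2.
have linkP k : k < l + 3 ->
  let d := link_dist (gam k.+1) (gam k) (gam k.+2) in
  d <= size (nth [::] (unzip2 BS) k) + 1 /\
  syl_length (eval (nth [::] (unzip2 BS) k)) <=
    3 * d + 2 * ((k == 1) + (k == l.+1)).
  move=> kl; have kB : k < size BS by rewrite szBS.
  have := block_path_link pBS sBS kB; rewrite -/gam /=.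
  set d := link_dist _ _ _ => -[h1 /(_ htri) h2 h3]; split=> //.
  have [k0|kn0] := eqVneq k 0.
    by rewrite k0 /=; apply: leq_trans (syl_length_eval _) _.
  have [kl2|knl2] := eqVneq k (l + 2).
    apply: leq_trans (syl_length_eval _) _.
    rewrite kl2 addn2 /= /unzip2 map_rcons nth_rcons size_map szbs.
    by rewrite ltnn eqxx.
  (* The ends of the geodesic are the only points where the link distance may be
     zero while the block is not trivial; each costs the 2 of [link_dist_ge].  At
     the other points [d + 2 <= 3 * d]. *)
  have [k1|kn1] := eqVneq k 1; first lia.
  have [kl1|knl1] := eqVneq k l.+1; first lia.
  suff : 0 < d by lia.
  apply: h3 => ek.
  have ep : edge_path (@ext_adj G) l (fun i => gam (2 + i)).
    by move=> i il; rewrite addnS; apply: epath; lia.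
  have := @gdist_geodesic _ _ _ _ (k - 2) k ep geo (leq_subr _ _).
  have -> : 2 + (k - 2) = k by lia.
  have -> : 2 + k = k.+2 by [].
  rewrite ek => e2; have := gdist_le (walk0 (@ext_adj G) (gam k.+2)); lia.
exists (l + 4), gam, v; split => //.
  have eK : l + 4 = 2 + l + 2 by lia.
  have le_dist p q : p <= q -> q <= l + 4 ->
      q - p <= gdist (@ext_adj G) (gam p) (gam q) + 8.
    move=> pq ql; rewrite eK in epath ql.
    exact: (hair_quasi_geodesic (@ext_adj_sym G) epath geo pq ql).
  move=> p q pl ql; wlog pq : p q pl ql / p <= q.
    move=> H; have [pq|/ltnW qp] := leqP p q; first exact: H.
    have wqp := edge_path_walk epath qp pl; have sym := @ext_adj_sym G.
    rewrite (gdist_sym sym (walk_sym sym wqp)).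
    by rewrite distrC; apply: H.
  have -> : (`|p%:R - q%:R| = (q - p)%N%:R :> rat)%R.
    by rewrite distrC -natrB // ger0_norm.
  have := le_dist p q pq ql; have := gdist_le (edge_path_walk epath pq ql).
  set d := gdist _ _ _ => h1 h2.
  by apply: asymp_nat; nia.
have -> : l + 4 = (l + 3).+1 by lia.
rewrite big_add1 /= big_mkord.
set S := \sum_(i < _) _.
have hS1 : S <= syl_length g + (l + 3).
  apply: leq_trans (leq_add szflat (leqnn _)); rewrite -fBS.
  rewrite -(@sum_size_nth _ (unzip2 BS) (l + 3)); last by rewrite size_map.
  rewrite -[X in _ + X]muln1 -[X in _ + X * _]card_ord -sum_nat_const -big_split.
  by apply: leq_sum => i _; have [] := linkP i (ltn_ord i).
have hS2 : syl_length g <= 3 * S + 4.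
  rewrite -syl_length_inv -ebs -fBS.
  apply: leq_trans (syl_length_flatten _) _.
  rewrite (big_nth [::]) size_map szBS big_mkord.
  have h : \sum_(i < l + 3) syl_length (eval (nth [::] (unzip2 BS) i)) <=
    \sum_(i < l + 3) (3 * link_dist (gam i.+1) (gam i) (gam i.+2)
      + (2 * (i == 1 :> nat) + 2 * (i == l.+1 :> nat))).
    by apply: leq_sum => i _; have [_] := linkP i (ltn_ord i); rewrite mulnDr.
  apply: leq_trans h _; rewrite big_split -big_distrr /= -/S leq_add2l.
  rewrite big_split -!big_distrr /=.
  rewrite -mulnDr -[4]/(2 * (1 + 1)) leq_mul2l /=.
  by apply: leq_add; apply: sum_eq_le.
by apply: asymp_nat; nia.
Qed.
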